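(* Consider the Pulse update on the complete directed graph $K_n^\rightarrow$ with vertex set $V$, $|V|=n$. Let $S_t\subseteq V$ be the active set at time $t$, and let $m=|S_t|$. Then the next active set is $$S_{t+1}=\begin{cases} V, & \text{if } m-1 \text{ is prime and } m \text{ is prime},\\ S_t, & \text{if } m-1 \text{ is prime and } m \text{ is not prime},\\ V\setminus S_t, & \text{if } m-1 \text{ is not prime and } m \text{ is prime},\\ \varnothing, & \text{if } m-1 \text{ is not prime and } m \text{ is not prime}. \end{cases}$$
   Context: $K_n^\rightarrow$ denotes the complete directed graph on $n$ vertices with no self-loops: for every pair of vertices $u\neq v$ the edge $u\to v$ is present. The Pulse update on a loopless directed graph $(V,E)$ acts on states $x_t:V\to\{0,1\}$ synchronously: with $k_t(v)=\sum_{u:(u,v)\in E}x_t(u)$, one sets $x_{t+1}(v)=1$ if $k_t(v)$ is a prime number and $x_{t+1}(v)=0$ otherwise. The active set at time $t$ is $S_t=\{v\in V: x_t(v)=1\}$. When $m=0$, the integer $m-1=-1$ is regarded as not prime. *)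

(* Defs.v *)
From mathcomp Require Import all_boot.

Set Implicit Arguments.
Unset Strict Implicit.
Unset Printing Implicit Defensive.

Record loopless_digraph (V : finType) := LooplessDigraph {
  edge : rel V;
  edge_irreflexive : irreflexive edge
}.

Section Pulse.

Variables (V : finType) (G : loopless_digraph V).

(* The values 0 and 1 are the booleans, which coerce to nat in sums. *)
Definition state := {ffun V -> bool}.

Definition active_in_count (x : state) (v : V) : nat :=
  \sum_(u : V | edge G u v) x u.

Definition pulse_step (x : state) : state :=
  [ffun v => prime (active_in_count x v)].

Definition pulse (x0 : state) (t : nat) : state := iter t pulse_step x0.

Definition active_set (x0 : state) (t : nat) : {set V} :=
  [set v | pulse x0 t v].

End Pulse.

Lemma neq_irreflexive (V : finType) : irreflexive (fun u v : V => u != v).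
Proof. by move=> v; rewrite eqxx. Qed.

Definition complete_digraph (V : finType) : loopless_digraph V :=
  LooplessDigraph (@neq_irreflexive V).

(* Main.v *)
Require Import Defs.
From mathcomp Require Import all_boot.

(** In the complete digraph a vertex receives one unit from every active vertex
    other than itself, so its count depends only on its own state: it is [m - 1]
    at an active vertex and [m] at an inactive one. Hence the primality of [m - 1]
    decides the fate of all active vertices at once, that of [m] the fate of all
    inactive ones, and the four combinations give the four cases. *)

(** The sum of the state over all vertices is the number of active vertices, and
    the absence of a self-loop drops exactly the term at [v]. *)
Lemma active_in_count_complete (V : finType) (x : state V) (v : V) :
  active_in_count (complete_digraph V) x v = #|[set u | x u]| - x v.
Proof.
have -> : #|[set u | x u]| = \sum_u x u.
  by rewrite -sum1dep_card big_mkcond; apply: eq_bigr => u _; case: (x u).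
by rewrite (bigD1 v) //= addKn.
Qed.

(* Truncated subtraction gives 0 - 1 = 0, and 0 is not prime, which agrees with
   the convention that -1 is not prime. *)
Theorem theorem11 (n : nat) (V : finType) (card_V : #|V| = n)
    (x0 : state V) (t : nat) :
  let S := active_set (complete_digraph V) x0 in
  let m := #|S t| in
  S t.+1 =
    match prime (m - 1), prime m with
    | true, true => [set: V]
    | true, false => S t
    | false, true => ~: S t
    | false, false => set0
    end.
Proof.
move=> S m; apply/setP => v.
have -> : (v \in S t.+1) = prime (m - (v \in S t)).
  by rewrite !inE /pulse /= ffunE active_in_count_complete.
rewrite !(fun_if (fun A : {set V} => v \in A)).
rewrite in_setT in_setC in_set0.
by case: (v \in S t); rewrite ?subn0; case: (prime (m - 1)); case: (prime m).
Qed.
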